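(* Let $X$ be a Banach function space over $\mathbb R^n$. Suppose that $m_\lambda$ is bounded on $X$ for some $\lambda\in(0,1)$. Then there exists $p>1$ such that the Hardy--Littlewood maximal operator $M$ is bounded on $X^{1/p}$.
   Context: Let $L^0(\mathbb R^n)$ be the space of measurable functions on $\mathbb R^n$. A vector space $X\subseteq L^0(\mathbb R^n)$ with a norm $\|\cdot\|_X$ is a Banach function space over $\mathbb R^n$ if: (Ideal property) if $f\in X$, $g\in L^0(\mathbb R^n)$ and $|g|\le|f|$, then $g\in X$ and $\|g\|_X\le\|f\|_X$; (Fatou property) if $0\le f_j\uparrow f$ with $f_j\in X$ and $\sup_j\|f_j\|_X<\infty$, then $f\in X$ and $\|f\|_X=\sup_j\|f_j\|_X$; (Saturation property) for every measurable $E\subset\mathbb R^n$ of positive measure there is a measurable $F\subseteq E$ of positive measure with $\chi_F\in X$. For $p>0$, $X^p$ is defined by $\|f\|_{X^p}:=\||f|^{1/p}\|_X^p$; thus $\|f\|_{X^{1/p}}=\||f|^p\|_X^{1/p}$, and $f\in X^{1/p}$ iff $|f|^p\in X$. The Hardy--Littlewood maximal operator is $Mf(x):=\sup_{Q\ni x}\frac1{|Q|}\int_Q|f|$, the supremum over all cubes $Q\subset\mathbb R^n$ containing $x$. For $\lambda\in(0,1)$ the $\lambda$-median maximal operator is $$m_\lambda f(x):=\sup_{Q\ni x}(f\chi_Q)^*(\lambda|Q|),$$ the supremum over all cubes containing $x$, where $f^*$ is the non-increasing rearrangement, i.e. $(f\chi_Q)^*(\lambda|Q|)=\inf\{\alpha>0:|\{x\in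 Q:|f(x)|>\alpha\}|\le\lambda|Q|\}$. An operator $T$ is bounded on a space $Y$ if there is $C>0$ such that $\|Tf\|_Y\le C\|f\|_Y$ for all $f\in Y$. *)

(* Defs.v *)
From HB Require Import structures.
From mathcomp Require Import all_boot all_order all_algebra.
From mathcomp Require Import all_classical all_reals all_analysis.

Set Implicit Arguments.
Unset Strict Implicit.
Unset Printing Implicit Defensive.

Import Order.TTheory GRing.Theory Num.Theory.
Import numFieldNormedType.Exports.

Local Open Scope classical_set_scope.
Local Open Scope ring_scope.

Section lebesgue_cons.
Context {R : realType} {n : nat}.
Local Notation RB := (measurableTypeR R).
Variable m : {sigma_finite_measure set (n.-tuple RB) -> \bar R}.

Definition tuple_cons (x : RB * n.-tuple RB) : n.+1.-tuple RB :=
  [the n.+1.-tuple RB of x.1 :: x.2].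

Lemma measurable_tuple_cons : measurable_fun setT tuple_cons.
Proof. exact: measurable_cons. Qed.

Lemma measurable_tuple_cons_preimage A :
  measurable A -> measurable (tuple_cons @^-1` A).
Proof.
by move=> mA; rewrite -[X in measurable X]setTI; exact: measurable_tuple_cons.
Qed.

Definition lebesgue_cons : set (n.+1.-tuple RB) -> \bar R :=
  pushforward (@lebesgue_measure R \x m)%E tuple_cons.

Let lebesgue_cons0 : lebesgue_cons set0 = 0%E.
Proof. by rewrite /lebesgue_cons /pushforward preimage_set0 measure0. Qed.

Let lebesgue_cons_ge0 A : (0 <= lebesgue_cons A)%E.
Proof. exact: (measure_ge0 (@lebesgue_measure R \x m)%E). Qed.

Let lebesgue_cons_semi_sigma_additive : semi_sigma_additive lebesgue_cons.
Proof.
move=> F mF tF mUF; rewrite /lebesgue_cons /pushforward preimage_bigcup.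
apply: measure_semi_sigma_additive.
- by move=> k; exact: measurable_tuple_cons_preimage.
- apply/trivIsetP => /= i j _ _ ij; rewrite -preimage_setI.
  by move/trivIsetP : tF => /(_ _ _ _ _ ij) ->//; rewrite preimage_set0.
- by rewrite -preimage_bigcup; exact: measurable_tuple_cons_preimage.
Qed.

HB.instance Definition _ := isMeasure.Build _ _ _ lebesgue_cons
  lebesgue_cons0 lebesgue_cons_ge0 lebesgue_cons_semi_sigma_additive.

Let product_lebesgue_sigma_finite :
  sigma_finite setT (@lebesgue_measure R \x m)%E.
Proof.
have /sigma_finiteP[F [TF ndF Foo]] := sigma_finiteT (@lebesgue_measure R).
have /sigma_finiteP[G [TG ndG Goo]] := sigma_finiteT m.
exists (fun k => F k `*` G k).
  rewrite -setXTT TF TG predeqE => -[x y]; split.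
    move=> [/= [i _ Fix] [k _ Gky]]; exists (maxn i k) => //; split.
    - by move: x Fix; exact/subsetPset/ndF/leq_maxl.
    - by move: y Gky; exact/subsetPset/ndG/leq_maxr.
  by move=> [k _ []/= ? ?]; split; exists k.
move=> k; have [? ?] := Foo k; have [? ?] := Goo k.
split; first exact: measurableX.
by rewrite product_measure1E// lte_mul_pinfty// ge0_fin_numE.
Qed.

Let lebesgue_cons_sigma_finite : sigma_finite setT lebesgue_cons.
Proof.
have [F UF mF] := product_lebesgue_sigma_finite.
pose d (y : n.+1.-tuple RB) : RB * n.-tuple RB :=
  (tnth y ord0, [tuple of behead y]).
have dK : cancel tuple_cons d.
  by move=> [x y]; rewrite /d /tuple_cons; congr (_, _); apply: val_inj.
have Kd : cancel d tuple_cons.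
  by move=> y; rewrite /d /tuple_cons/= [in RHS](tuple_eta y); apply: val_inj.
have md : measurable_fun setT d.
  apply: measurable_fun_pair; first exact: measurable_tnth.
  exact: measurable_behead.
exists (fun i => d @^-1` F i).
  by rewrite -preimage_bigcup -UF preimage_setT.
move=> i; split.
  by rewrite -[X in measurable X]setTI; apply: md => //; have [] := mF i.
rewrite /lebesgue_cons /pushforward -comp_preimage.
rewrite (_ : d \o tuple_cons = id) ?preimage_id; last exact/funext.
by have [] := mF i.
Qed.

HB.instance Definition _ := Measure_isSigmaFinite.Build _ _ _ lebesgue_cons
  lebesgue_cons_sigma_finite.

End lebesgue_cons.

Fixpoint borel_lebesgue (R : realType) (n : nat) :
    {sigma_finite_measure set (n.-tuple (measurableTypeR R)) -> \bar R} :=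
  if n is k.+1 then lebesgue_cons (borel_lebesgue R k)
  else \d_([tuple] : 0.-tuple (measurableTypeR R)).

Lemma measurable_borel_cube (R : realType) (n : nat) (a : n.-tuple R) (l : R) :
  measurable ([set x | forall i : 'I_n, tnth a i <= tnth x i <= tnth a i + l]
    : set (n.-tuple (measurableTypeR R))).
Proof.
rewrite (_ : mkset _ = \bigcap_(i : 'I_n)
    ((fun x : n.-tuple (measurableTypeR R) => tnth x i) @^-1`
      `[tnth a i, tnth a i + l])); last first.
  apply/seteqP; split=> x /= H i; first by move=> _ /=; rewrite in_itv/=.
  by have := H i Logic.I; rewrite /= in_itv/=.
apply: fin_bigcap_measurable => //.
by move=> i _; rewrite -[X in measurable X]setTI; apply: measurable_tnth.
Qed.

Lemma borel_lebesgue_cube (R : realType) (n : nat) (a : n.-tuple R) (l : R) :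
  0 <= l ->
  borel_lebesgue R n
    [set x | forall i : 'I_n, tnth a i <= tnth x i <= tnth a i + l] =
  (l ^+ n)%:E.
Proof.
move=> l0; elim: n a => [|n IH] a.
  rewrite /= diracE expr0 (_ : _ \in _) //.
  by rewrite inE => -[].
rewrite /= /lebesgue_cons /pushforward.
rewrite (_ : _ @^-1` _ = `[tnth a ord0, tnth a ord0 + l] `*`
  [set x | forall i : 'I_n, tnth [tuple of behead a] i <= tnth x i
                                  <= tnth [tuple of behead a] i + l]).
  rewrite product_measure1E//; [|exact: measurable_borel_cube].
  rewrite [X in (_ * X)%E](IH [tuple of behead a]).
  have leb_itv : lebesgue_measure
      `[tnth a ord0, tnth a ord0 + l] = l%:E; last first.
    by rewrite [X in (X * _)%E]leb_itv -EFinM exprS.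
  rewrite lebesgue_measure_itv /= lte_fin; case: ltrP => h.
    by rewrite -EFinD addrC addKr.
  have -> : l = 0.
    by apply/eqP; rewrite eq_le l0 andbT -(lerD2l (tnth a ord0)) addr0.
  by [].
apply/seteqP; split => -[x y] /=; rewrite ?in_itv/=.
  move=> H; split; first by have := H ord0; rewrite /= !(tnth_nth 0).
  move=> i; have := H (lift ord0 i).
  by rewrite !(tnth_nth 0) /= nth_behead.
move=> [h0 H] i; case: (unliftP ord0 i) => [j ->|->]; last by move: h0; rewrite !(tnth_nth 0).
by have := H j; rewrite !(tnth_nth 0) /= nth_behead.
Qed.

(* Points of R^n are n-tuples; as a measurable type, R^n carries the complete
   sigma-algebra of Lebesgue measurable sets, not only the Borel sets. *)
Definition Rn (R : realType) (n : nat) :=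
  caratheodory_type ((borel_lebesgue R n)^*)%mu.

HB.instance Definition _ (R : realType) (n : nat) := Measurable.on (Rn R n).

Definition lebesgueRn (R : realType) (n : nat) : set (Rn R n) -> \bar R :=
  @completed_measure_extension _ _ _ (borel_lebesgue R n).

HB.instance Definition _ (R : realType) (n : nat) :=
  Measure.on (@lebesgueRn R n).

Lemma lebesgueRn_sigma_finite (R : realType) (n : nat) :
  sigma_finite setT (@lebesgueRn R n).
Proof. exact/completed_measure_extension_sigma_finite/sigma_finiteT. Qed.

HB.instance Definition _ (R : realType) (n : nat) :=
  Measure_isSigmaFinite.Build _ _ _ (@lebesgueRn R n)
    (@lebesgueRn_sigma_finite R n).

Section function_spaces.
Context {R : realType} {n : nat}.
Local Notation mu := (@lebesgueRn R n).

(* Cubes are closed, with sides parallel to the axes and positive side length. *)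
Definition cube (a : Rn R n) (l : R) : set (Rn R n) :=
  [set x | forall i : 'I_n, tnth a i <= tnth x i <= tnth a i + l].

Definition is_cube (Q : set (Rn R n)) := exists a l, 0 < l /\ Q = cube a l.

Lemma lebesgueRn_cube (a : Rn R n) (l : R) : 0 <= l ->
  mu (cube a l) = (l ^+ n)%:E.
Proof.
move=> l0; rewrite /lebesgueRn /completed_measure_extension.
rewrite measurable_mu_extE//; first exact: borel_lebesgue_cube.
exact: measurable_borel_cube.
Qed.

(* Elements of L^0 are represented by everywhere defined functions, and all
   (in)equalities between them are meant almost everywhere. The value of fnorm
   outside the carrier is irrelevant. *)
Record fun_space := FunSpace {
  carrier :> (Rn R n -> R) -> Prop ;
  fnorm : (Rn R n -> R) -> R }.

Record banach_function_space (X : fun_space) : Prop := BanachFunctionSpace {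
  bfs_measurable : forall f, X f -> measurable_fun setT f ;
  bfs0 : X (cst 0) ;
  bfsD : forall f g, X f -> X g -> X (f \+ g) ;
  bfsZ : forall (c : R) f, X f -> X (fun x => c * f x) ;
  bfs_norm_ge0 : forall f, X f -> 0 <= fnorm X f ;
  bfs_norm_eq0 : forall f, X f -> fnorm X f = 0 -> {ae mu, forall x, f x = 0} ;
  bfs_normZ : forall (c : R) f, X f ->
    fnorm X (fun x => c * f x) = `|c| * fnorm X f ;
  bfs_normD : forall f g, X f -> X g ->
    fnorm X (f \+ g) <= fnorm X f + fnorm X g ;
  bfs_ideal : forall f (g : Rn R n -> R), X f -> measurable_fun setT g ->
    {ae mu, forall x, `|g x| <= `|f x|} ->
    X g /\ fnorm X g <= fnorm X f ;
  bfs_fatou : forall (u : (Rn R n -> R)^nat) (f : Rn R n -> R),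
    (forall j, X (u j)) ->
    measurable_fun setT f ->
    {ae mu, forall x, [/\ forall j, 0 <= u j x,
      nondecreasing_seq (u ^~ x) & u ^~ x @ \oo --> f x]} ->
    has_ubound (range (fnorm X \o u)) ->
    X f /\ fnorm X f = sup (range (fnorm X \o u)) ;
  bfs_saturation : forall E : set (Rn R n), measurable E -> (0 < mu E)%E ->
    exists F, [/\ measurable F, F `<=` E, (0 < mu F)%E & X \1_F] }.

Definition fun_space_pow (X : fun_space) (p : R) : fun_space := {|
  carrier := fun f => measurable_fun setT f /\
    X (fun x => `|f x| `^ p^-1) ;
  fnorm := fun f => fnorm X (fun x => `|f x| `^ p^-1) `^ p |}.

Definition bounded_on (T : (Rn R n -> R) -> Rn R n -> \bar R)
    (Y : fun_space) :=
  exists C : R, 0 < C /\ forall f, Y f ->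
    [/\ {ae mu, forall x, T f x \is a fin_num},
        Y (fine \o T f) & fnorm Y (fine \o T f) <= C * fnorm Y f].

Local Open Scope ereal_scope.

Definition hardy_littlewood (f : Rn R n -> R) (x : Rn R n) : \bar R :=
  ereal_sup [set (mu Q)^-1 * \int[mu]_(y in Q) `|f y|%:E
            | Q in [set Q | is_cube Q /\ Q x]].

Definition rearrangement (f : Rn R n -> R) (t : \bar R) : \bar R :=
  ereal_inf [set a%:E
            | a in [set a : R | (0 < a)%R /\ mu [set x | (a < `|f x|)%R] <= t]].

Definition median_maximal (lambda : R) (f : Rn R n -> R) (x : Rn R n) :
    \bar R :=
  ereal_sup [set rearrangement (f \* \1_Q)%R (lambda%:E * mu Q)
            | Q in [set Q | is_cube Q /\ Q x]].

End function_spaces.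

Arguments fun_space : clear implicits.

(* Main.v *)
Require Import Defs.
From mathcomp Require Import all_boot all_order all_algebra.
From mathcomp Require Import all_classical all_reals all_analysis.
From mathcomp Require Import measurable_realfun.
From mathcomp Require Import ring lra.

(** Write m for the lambda-median maximal operator m_lambda. For g = |f|^p,
    boundedness of m on X makes the iterates u_0 = g, u_(k+1) = u_k + m u_k
    grow at most geometrically in norm, so that for large D the series
    G = sum_k D^-k u_k stays in X with norm at most twice that of g
    ([bfs_dominate_series]). The proof bounds (Mf)^p by a constant times G
    almost everywhere. All dependence on X is in the construction of G; the
    rest is a pointwise statement about cubes.

    Iterating m amplifies level sets. If E = {u_k >= alpha} has density more
    than lambda in a cube P, then m u_k >= alpha on all of P. So the next level
    set F = {u_(k+1) >= alpha} contains E and, up to null sets, every cube in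
    which E has density more than lambda. The geometric core ([growth]) is
    that such an F satisfies |Q & F| >= theta |Q & E|, for a constant
    theta > 1 depending on n and lambda, as long as |Q & E| <= lambda |Q|.
    Hence a level set {g >= alpha} of relative measure more than
    lambda theta^-k in Q reaches density more than lambda in Q within k steps,
    and u_(k+1) >= alpha almost everywhere on Q ([median_iterates_ge]). Read
    backwards, at almost every point x of Q the inequality D^-(k+1) u_(k+1)(x) <= G(x)
    says that |f| exceeds D^((k+1)/p) G(x)^(1/p) only on a part of Q of
    relative measure at most theta^-k. When D^(1/p) < theta, that is, for p
    large, summing over k bounds the average of |f| over Q by a constant times
    G(x)^(1/p) ([integral_normr_geometric], [hardy_littlewood_le]).

    Growth is proved by induction over dyadic subcubes, without covering lemmas
    and for lambda arbitrarily close to 1. Consider a dyadic cube in which E has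
    density at most lambda. If one of its children is denser than lambda, a cube
    between that child and its parent has density in
    (lambda, 2 lambda / (1 + lambda)] ([intermediate_density]); it is swallowed
    by F, and a fixed part of it lies outside E. If no child is dense, the
    estimates on the children add up. The error left at depth N is a multiple of
    the sum over the dyadic subcubes P of generation N of min(|P & E|, |P \ E|),
    which tends to 0 for every measurable E ([mixing_cvg0]); this is the form of
    the density theorem used here. *)

Set Implicit Arguments.
Unset Strict Implicit.
Unset Printing Implicit Defensive.
Import Order.TTheory GRing.Theory Num.Theory.
Import numFieldNormedType.Exports.
Local Open Scope classical_set_scope.
Local Open Scope ring_scope.

(** * Half-open cubes and their volume *)

Lemma bernoulli_le (R : realType) (e : R) (k : nat) : 0 <= e -> e <= 1 ->
  1 - k%:R * e <= (1 - e) ^+ k.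
Proof.
move=> e0 e1; elim: k => [|k IH]; first by rewrite expr0 mul0r subr0.
have h : (1 - k%:R * e) * (1 - e) <= (1 - e) ^+ k.+1.
  by rewrite exprSr ler_wpM2r// subr_ge0.
apply: le_trans h; rewrite -natr1.
have : 0 <= k%:R * (e * e) by rewrite mulr_ge0 ?mulr_ge0.
lra.
Qed.

Section half_open_cubes.
Context {R : realType} {n : nat}.
Local Notation mu := (@lebesgueRn R n).
Implicit Types (a x : Rn R n) (l s t : R) (E F : set (Rn R n)).

(** Unlike the closed cubes, these are partitioned exactly by their dyadic
    children. *)
Definition hcube a l : set (Rn R n) :=
  [set x | forall i : 'I_n, tnth a i <= tnth x i < tnth a i + l].

Lemma measurable_Rn_borel (A : set (n.-tuple (measurableTypeR R))) :
  measurable A -> measurable (A : set (Rn R n)).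
Proof. exact: caratheodory_measurable_mu_ext. Qed.

Lemma measurable_Rn_coord (B : set (measurableTypeR R)) (i : 'I_n) :
  measurable B -> measurable ([set x | B (tnth x i)] : set (Rn R n)).
Proof.
move=> mB; apply: measurable_Rn_borel.
rewrite (_ : mkset _ = setT `&`
    ((fun x : n.-tuple (measurableTypeR R) => tnth x i) @^-1` B)).
  exact: measurable_tnth.
by rewrite setTI.
Qed.

Lemma measurable_cube a l : measurable (cube a l).
Proof. by apply: measurable_Rn_borel; exact: measurable_borel_cube. Qed.

Lemma measurable_hcube a l : measurable (hcube a l).
Proof.
rewrite (_ : hcube a l = \bigcap_(i : 'I_n)
    [set x | `[tnth a i, tnth a i + l[%classic (tnth x i)]).
  by apply: fin_bigcap_measurable => // i _; exact: measurable_Rn_coord.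
apply/seteqP; split=> x /= H i; first by move=> _ /=; rewrite in_itv/=.
by have := H i Logic.I; rewrite /= in_itv/=.
Qed.
Hint Resolve measurable_hcube measurable_cube : core.

Lemma hcube_sub_cube a l : hcube a l `<=` cube a l.
Proof. by move=> x H i; have /andP[-> /ltW->] := H i. Qed.

Lemma lebesgueRn_hcube a l : 0 < l -> mu (hcube a l) = (l ^+ n)%:E.
Proof.
move=> l0; have l0' := ltW l0; apply/eqP; rewrite eq_le; apply/andP; split.
  rewrite -(lebesgueRn_cube a l0').
  by apply: le_measure; rewrite ?inE//; exact: hcube_sub_cube.
(* The closed cubes of side l (1 - e) fit into the half-open one. *)
have key e : 0 < e -> e <= 1 -> ((l ^+ n * (1 - n%:R * e))%:E <= mu (hcube a l))%E.
  move=> e0 e1.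
  have le0 : 0 <= l * (1 - e) by rewrite mulr_ge0// subr_ge0.
  apply: (@le_trans _ _ (mu (cube a (l * (1 - e))))).
    rewrite lebesgueRn_cube// exprMn lee_fin ler_wpM2l ?exprn_ge0//.
    by apply: bernoulli_le => //; exact: ltW.
  apply: le_measure; rewrite ?inE// => x H i; have /andP[-> h] := H i.
  apply: (le_lt_trans h); rewrite ltrD2l gtr_pMr//; lra.
apply/lee_subgt0Pr => d d0.
have Kp : 0 < l ^+ n * n%:R + d by rewrite ltr_wpDl// mulr_ge0// exprn_ge0.
pose e := d / (l ^+ n * n%:R + d).
have e0 : 0 < e by rewrite divr_gt0.
have e1 : e <= 1.
  by rewrite ler_pdivrMr// mul1r lerDr mulr_ge0// exprn_ge0.
apply: le_trans (key e e0 e1); rewrite -EFinD lee_fin.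
have : l ^+ n * n%:R * e <= d.
  rewrite /e mulrA ler_pdivrMr// mulrC ler_wpM2l ?ltW//.
  by rewrite ltrDl.
by rewrite mulrBr mulr1 (mulrA _ _ e) lerD2l lerN2.
Qed.

Definition vol E a l : R := fine (mu (hcube a l `&` E)).

Lemma mu_hcubeI_fin E a l : measurable E -> mu (hcube a l `&` E) \is a fin_num.
Proof.
move=> mE; rewrite ge0_fin_numE//.
apply: (@le_lt_trans _ _ (mu (cube a `|l|))).
  apply: le_measure; rewrite ?inE//; first exact: measurableI.
  move=> x [H _] i; have /andP[-> /ltW h] := H i; apply: (le_trans h).
  by rewrite lerD2l ler_norm.
by rewrite lebesgueRn_cube ?ltry.
Qed.

Lemma volE E a l : measurable E -> mu (hcube a l `&` E) = (vol E a l)%:E.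
Proof. by move=> mE; rewrite /vol fineK// mu_hcubeI_fin. Qed.

Lemma vol_ge0 E a l : 0 <= vol E a l.
Proof. exact/fine_ge0/measure_ge0. Qed.

Lemma vol_le E F a l : measurable E -> measurable F ->
  hcube a l `&` E `<=` F -> vol E a l <= vol F a l.
Proof.
move=> mE mF EF; rewrite -lee_fin -!volE//.
apply: le_measure; rewrite ?inE; [exact: measurableI|exact: measurableI|].
by move=> x [Px Ex]; split => //; exact: EF.
Qed.

Lemma vol_sub E a l a' l' : measurable E -> hcube a l `<=` hcube a' l' ->
  vol E a l <= vol E a' l'.
Proof.
move=> mE sub; rewrite -lee_fin -!volE//.
by apply: le_measure; rewrite ?inE; [exact: measurableI..|exact: setSI].
Qed.

Lemma volT a l : 0 < l -> vol setT a l = l ^+ n.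
Proof. by move=> l0; rewrite /vol setIT lebesgueRn_hcube. Qed.

Lemma volID E F a l : measurable E -> measurable F ->
  vol E a l = vol (E `&` F) a l + vol (E `&` ~` F) a l.
Proof.
move=> mE mF; apply: EFin_inj; rewrite EFinD -!volE//.
- rewrite !setIA -setDE.
  rewrite (@measureDI _ _ _ mu (hcube a l `&` E) F)//; last exact: measurableI.
  by rewrite addeC.
- by apply: measurableI => //; exact: measurableC.
- exact: measurableI.
Qed.

Lemma volU E F a l : measurable E -> measurable F ->
  vol (E `|` F) a l <= vol E a l + vol F a l.
Proof.
move=> mE mF; rewrite (@volID (E `|` F) E)//; last exact: measurableU.
apply: lerD; apply: vol_le => //; repeat
  (first [exact: measurableU|exact: measurableC|apply: measurableI => //]).
- by move=> x [_ []].
- by move=> x [_ [[]]].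
Qed.

Lemma volC E a l : measurable E -> 0 < l ->
  vol E a l + vol (~` E) a l = l ^+ n.
Proof. by move=> mE l0; rewrite -(volT a l0) (@volID setT E)// !setTI. Qed.

(** Base point of the cube of side [s] inscribed in [hcube a l] at the vertex
    selected by [b]: for [s = l / 2] these are the dyadic children, and letting
    [s] increase to [l] interpolates between a child and its parent. *)
Definition corner a l s (b : {ffun 'I_n -> bool}) : Rn R n :=
  [tuple tnth a i + (if b i then l - s else 0) | i < n].

Lemma corner_full a l b : corner a l l b = a.
Proof.
apply: eq_from_tnth => i; rewrite tnth_mktuple subrr.
by case: ifP; rewrite addr0.
Qed.

Lemma corner_sub a l s b : s <= l -> hcube (corner a l s b) s `<=` hcube a l.
Proof.
move=> sl x H i; have := H i; rewrite tnth_mktuple.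
by case: ifP => _ /andP[h1 h2]; apply/andP; split; lra.
Qed.

Lemma corner_mono a l s t b : s <= t -> t <= l ->
  hcube (corner a l s b) s `<=` hcube (corner a l t b) t.
Proof.
move=> st tl x H i; have := H i; rewrite !tnth_mktuple.
by case: ifP => _ /andP[h1 h2]; apply/andP; split; lra.
Qed.

Lemma hcube_children a l : 0 < l ->
  hcube a l = \bigcup_(b in [set: {ffun 'I_n -> bool}])
    hcube (corner a l (l / 2) b) (l / 2).
Proof.
move=> l0; apply/seteqP; split=> [x H|x [b _]]; last first.
  by apply: corner_sub; rewrite ler_pdivrMr// ler_pMr// ler1n.
exists [ffun i => tnth a i + l / 2 <= tnth x i] => // i.
rewrite tnth_mktuple ffunE; have /andP[h1 h2] := H i.
by case: ifPn => [h|]; [|rewrite -ltNge => h]; apply/andP; split; lra.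
Qed.

Lemma hcube_children_disjoint a l :
  trivIset [set: {ffun 'I_n -> bool}]
    (fun b => hcube (corner a l (l / 2) b) (l / 2)).
Proof.
move=> b c _ _ [x [Hb Hc]]; apply/ffunP => i.
have := Hb i; have := Hc i; rewrite !tnth_mktuple.
by case: (b i); case: (c i) => // /andP[h1 h2] /andP[h3 h4]; exfalso; lra.
Qed.

Lemma vol_children E a l : measurable E -> 0 < l ->
  vol E a l = \sum_b vol E (corner a l (l / 2) b) (l / 2).
Proof.
move=> mE l0; apply: EFin_inj; rewrite -sumEFin -volE//.
under eq_bigr do rewrite -volE//.
rewrite {1}hcube_children// setI_bigcupl measure_fin_bigcup//; last 2 first.
- by apply: trivIset_setIr; exact: hcube_children_disjoint.
- by move=> b _; exact: measurableI.
rewrite fsbig_finite//= (perm_big (enum {ffun 'I_n -> bool}))/=.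
  by rewrite big_enum.
apply: uniq_perm; rewrite ?finmap.fset_uniq ?enum_uniq// => b.
rewrite mem_enum in_fset_set; last exact: finite_finset.
by rewrite in_setT.
exact: finite_finset.
Qed.

End half_open_cubes.

(** * Density of measurable sets along dyadic subdivisions *)

Section mixing.
Context {R : realType} {n : nat}.
Local Notation mu := (@lebesgueRn R n).
Implicit Types (a x : Rn R n) (l s t e : R) (E F : set (Rn R n)).
#[local] Hint Resolve measurable_hcube measurable_cube : core.

(** Sum over the dyadic subcubes [P] of generation [N] of the smaller of
    |P & E| and |P \ E|: it vanishes when each of them is almost contained in
    [E] or almost disjoint from it. *)
Fixpoint mixing (N : nat) E a l : R :=
  if N is k.+1 then \sum_b mixing k E (corner a l (l / 2) b) (l / 2)
  else Num.min (vol E a l) (vol (~` E) a l).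

Lemma mixingC N E a l : mixing N (~` E) a l = mixing N E a l.
Proof.
elim: N a l => [|N IH] a l /=; first by rewrite setCK minC.
by apply: eq_bigr => b _; exact: IH.
Qed.

Lemma mixing_ge0 (N : nat) E a l : 0 <= mixing N E a l.
Proof.
elim: N a l => [|N IH] a l /=; first by rewrite le_min !vol_ge0.
by apply: sumr_ge0 => b _; exact: IH.
Qed.

Lemma mixing_le_vol N E a l : measurable E -> 0 < l ->
  mixing N E a l <= vol E a l.
Proof.
move=> mE; elim: N a l => [|N IH] a l l0 /=; first by rewrite ge_min lexx.
rewrite (vol_children a mE l0); apply: ler_sum => b _; apply: IH.
by rewrite divr_gt0.
Qed.

Lemma mixingU N E F a l : measurable E -> measurable F ->
  mixing N (E `|` F) a l <= mixing N E a l + mixing N F a l.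
Proof.
move=> mE mF; elim: N a l => [|N IH] a l /=; last first.
  by rewrite -big_split/=; apply: ler_sum => b _; exact: IH.
have h : vol (~` (E `|` F)) a l <= Num.min (vol (~` E) a l) (vol (~` F) a l).
  have mU : measurable (~` (E `|` F)) by exact/measurableC/measurableU.
  rewrite le_min !vol_le//; try exact: measurableC.
  - by move=> x [_ nEF]; apply: contra_not nEF; right.
  - by move=> x [_ nEF]; apply: contra_not nEF; left.
move: h (volU a l mE mF) (vol_ge0 E a l) (vol_ge0 F a l).
move: (vol_ge0 (~` E) a l) (vol_ge0 (~` F) a l).
rewrite !minEle; repeat case: ifP => //; move=> *; lra.
Qed.

(** Only the layer of subcubes crossed by the bounding hyperplane contributes,
    and each subdivision halves the volume of that layer. *)
Lemma mixing_halfspace N (i : 'I_n) t a l : 0 < l ->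
  mixing N [set x : Rn R n | tnth x i < t] a l <= 2 ^- N * l ^+ n.
Proof.
set E := mkset _.
have mE : measurable E.
  have := @measurable_Rn_coord R n `]-oo, t[%classic i (measurable_itv _).
  by congr measurable; apply/seteqP; split=> x /=; rewrite in_itv.
elim: N a l => [|N IH] a l l0.
  rewrite expr0 invr1 mul1r; apply: (le_trans (mixing_le_vol 0 a mE l0)).
  by rewrite -(volT a l0); exact: vol_le.
have l20 : 0 < l / 2 by rewrite divr_gt0.
set w := 2 ^- N * (l / 2) ^+ n.
have w0 : 0 <= w by rewrite mulr_ge0// ?exprn_ge0 ?ltW// invr_gt0 exprn_gt0.
(* The hyperplane misses one of the two layers of children, on which the
   half-space is then null or full. *)
have [c hc] : exists c : bool, forall b : {ffun 'I_n -> bool}, b i = c ->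
    mixing N E (corner a l (l / 2) b) (l / 2) <= 0.
  have [tm|mt] := lerP t (tnth a i + l / 2).
    exists true => b bi; apply: (le_trans (mixing_le_vol _ _ mE l20)).
    rewrite /vol (_ : _ `&` _ = set0) ?measure0//.
    apply/seteqP; split=> // x [/(_ i)]; rewrite tnth_mktuple bi /E/=.
    by move=> /andP[h1 h2] h3; lra.
  exists false => b bi; rewrite -mixingC.
  apply: (le_trans (mixing_le_vol _ _ (measurableC mE) l20)).
  rewrite /vol (_ : _ `&` _ = set0) ?measure0//.
  apply/seteqP; split=> // x [/(_ i)]; rewrite tnth_mktuple bi /E/=.
  by move=> /andP[h1 h2] h3; apply: h3; lra.
have le1 : mixing N.+1 E a l <= \sum_(b : {ffun 'I_n -> bool}) if b i == c then 0 else w.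
  by apply: ler_sum => b _; case: eqP => [/hc//|_]; exact: IH.
apply: (le_trans le1).
have sumw : \sum_(b : {ffun 'I_n -> bool}) w = 2 ^- N * l ^+ n.
  rewrite -(volT a l0) vol_children// mulr_sumr.
  by apply: eq_bigr => b _; rewrite volT.
pose flip (b : {ffun 'I_n -> bool}) := [ffun j => (j == i) (+) b j].
have flipK : involutive flip.
  by move=> b; apply/ffunP => j; rewrite !ffunE addKb.
(* Flipping the [i]-th bit exchanges the two layers of children, so each of
   them has half of the volume. *)
have eq2 : \sum_(b : {ffun 'I_n -> bool}) (if b i == c then 0 else w) =
           \sum_(b : {ffun 'I_n -> bool}) (if b i == c then w else 0).
  rewrite (reindex_inj (inv_inj flipK))/=; apply: eq_bigr => b _.
  by rewrite ffunE eqxx; case: (b i); case: c {hc le1}.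
have : \sum_(b : {ffun 'I_n -> bool}) (if b i == c then 0 else w) +
       \sum_(b : {ffun 'I_n -> bool}) (if b i == c then w else 0) =
       2 ^- N * l ^+ n.
  rewrite -big_split/= -sumw; apply: eq_bigr => b _.
  by case: ifP; rewrite ?add0r ?addr0.
by rewrite -eq2 exprS invfM; lra.
Qed.

Definition vanishing_mixing E := measurable E /\ forall a l, 0 < l ->
  forall e, 0 < e -> \forall N \near \oo, mixing N E a l < e.

Lemma vanishing_mixingU E F : vanishing_mixing E -> vanishing_mixing F ->
  vanishing_mixing (E `|` F).
Proof.
move=> [mE vE] [mF vF]; split; first exact: measurableU.
move=> a l l0 e e0; have e20 : 0 < e / 2 by rewrite divr_gt0.
have hE := vE a l l0 _ e20; have hF := vF a l l0 _ e20.
near=> N; apply: (le_lt_trans (mixingU _ _ _ mE mF)).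
rewrite [ltRHS]splitr ltrD//; near: N => //.
Unshelve. all: by end_near. Qed.

(** A countable union is a finite union up to a set of small volume in the
    given cube, and the volume bounds the mixing. *)
Lemma sigma_algebra_vanishing_mixing : sigma_algebra setT vanishing_mixing.
Proof.
split.
- split=> // a l l0 e e0; near=> N.
  apply: (le_lt_trans (mixing_le_vol _ _ measurable0 l0)).
  by rewrite /vol setI0 measure0.
- move=> E [mE vE]; rewrite setTD; split; first exact: measurableC.
  by move=> a l l0 e e0; under eq_near do rewrite mixingC; exact: vE.
- move=> F vF.
  have mF i : measurable (F i) by have [] := vF i.
  pose U k := \big[setU/set0]_(i < k) F i.
  have vU k : vanishing_mixing (U k).
    rewrite /U; elim: k => [|k IH].
      rewrite big_ord0; split=> // a l l0 e e0; near=> N.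
      apply: (le_lt_trans (mixing_le_vol _ _ measurable0 l0)).
      by rewrite /vol setI0 measure0.
    by rewrite big_ord_recr/=; exact: vanishing_mixingU.
  have mU k : measurable (U k) by have [] := vU k.
  have mUF : measurable (\bigcup_i F i) by exact: bigcupT_measurable.
  split=> // a l l0 e e0; have e20 : 0 < e / 2 by rewrite divr_gt0.
  pose T k := hcube a l `&` (\bigcup_i F i `\` U k).
  have mT k : measurable (T k) by apply: measurableI => //; exact: measurableD.
  have T0 : mu (T k) @[k --> \oo] --> mu (\bigcap_k T k).
    apply: nonincreasing_cvg_mu => //.
    + have := mu_hcubeI_fin a l (measurableD mUF (mU 0)).
      by rewrite -ge0_fin_numE.
    + exact: bigcapT_measurable.
    + apply/nonincreasing_seqP => k; apply/subsetPset.
      apply: setIS; apply: setDS.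
      by rewrite /U big_ord_recr; exact: subsetUl.
  rewrite (_ : \bigcap_k T k = set0) ?measure0 in T0; last first.
    apply/seteqP; split=> // x Tx; have [_ [[i _ Fix] _]] := Tx 0%N Logic.I.
    have [_ [_]] := Tx i.+1 Logic.I; apply.
    by rewrite /U big_ord_recr/=; right.
  have [k Tk] : exists k, vol (\bigcup_i F i `\` U k) a l < e / 2.
    have /fine_cvgP[_] := T0.
    move=> /cvgrPdist_lt/(_ _ e20)[k _ /(_ k (leqnn k))/=].
    rewrite sub0r normrN => h; exists k; exact: le_lt_trans (ler_norm _) h.
  near=> N.
  have -> : \bigcup_i F i = U k `|` (\bigcup_i F i `\` U k).
    rewrite setDUK// /U => x; rewrite -bigcup_mkord => -[i _ Fix].
    by exists i.
  apply: (le_lt_trans (mixingU _ _ _ (mU k) (measurableD mUF (mU k)))).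
  rewrite [ltRHS]splitr ltr_leD//.
    by near: N; apply: (vU k).2.
  apply: (le_trans (mixing_le_vol _ _ _ l0)); last exact: ltW.
  exact: measurableD.
Unshelve. all: by end_near. Qed.

End mixing.

Section mixing_vanishes.
Context {R : realType} {n : nat}.
Local Notation mu := (@lebesgueRn R n).
Implicit Types (a x : Rn R n) (l s t e : R) (E F : set (Rn R n)).
#[local] Hint Resolve measurable_hcube measurable_cube : core.

(** The half-spaces generate the Borel sets. *)
Lemma vanishing_mixing_borel (B : set (n.-tuple (measurableTypeR R))) :
  measurable B -> @vanishing_mixing R n B.
Proof.
apply: smallest_sub; first exact: sigma_algebra_vanishing_mixing.
pose vanishing (G : set (set (n.-tuple R))) := G `<=` @vanishing_mixing R n.
apply: (@big_ind _ vanishing) => //.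
  by move=> G H GV HV A [/GV|/HV].
move=> i _ _ [B' mB' <-]; rewrite setTI.
suff : measurable `<=` image_set_system setT
    (fun x : Rn R n => tnth x i) (@vanishing_mixing R n).
  by move=> /(_ _ mB'); rewrite /image_set_system/= setTI.
rewrite RGenCInfty.measurableE; apply: smallest_sub.
  by apply: sigma_algebra_image; exact: sigma_algebra_vanishing_mixing.
move=> _ [t ->]; rewrite /image_set_system/= setTI.
rewrite (_ : _ @^-1` _ = setT `\` [set x : Rn R n | tnth x i < t]); last first.
  rewrite setTD; apply/seteqP; split=> x /=; rewrite in_itv/= andbT leNgt.
    by move/negP.
  by move/negP.
have [_ + _] := @sigma_algebra_vanishing_mixing R n; apply; split.
  have := @measurable_Rn_coord R n `]-oo, t[%classic i (measurable_itv _).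
  by congr measurable; apply/seteqP; split=> x /=; rewrite in_itv.
move=> a l l0 e e0.
have h : (2 ^- N * l ^+ n) @[N --> \oo] --> (0 : R).
  rewrite -[X in _ --> X](mul0r (l ^+ n)).
  apply: cvgMl; under eq_fun do rewrite -exprVn.
  by apply: cvg_expr; rewrite ger0_norm ?invr_ge0// invf_lt1// ltr1n.
move/cvgrPdist_lt : h => /(_ _ e0); apply: filterS => N.
rewrite sub0r normrN => h; apply: (le_lt_trans (mixing_halfspace N i t a l0)).
exact: le_lt_trans (ler_norm _) h.
Qed.

(** The measure is defined as the outer measure of the Borel one, so inside a
    cube every measurable set is a Borel set up to small volume. *)
Lemma mixing_cvg0 E a l e : measurable E -> 0 < l -> 0 < e ->
  exists N, mixing N E a l < e.
Proof.
move=> mE l0 e0; pose E' := hcube a l `&` E.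
have mE' : measurable E' by exact: measurableI.
have fE' : mu E' \is a fin_num by exact: mu_hcubeI_fin.
have [B [mB EB muB]] : exists B : set (n.-tuple (measurableTypeR R)),
    [/\ measurable B, E' `<=` B & (mu B < mu E' + (e / 2)%:E)%E].
  have e20 : 0 < e / 2 by rewrite divr_gt0.
  have [_ [F [mF EF] <-]] := lb_ereal_inf_adherent e20 fE'.
  move=> lt; exists (\bigcup_k F k); split=> //; first exact: bigcupT_measurable.
  apply: le_lt_trans lt.
  rewrite /lebesgueRn /completed_measure_extension measurable_mu_extE//;
    last exact: bigcupT_measurable.
  apply: (@measure_sigma_subadditive _ _ _ (borel_lebesgue R n)) => //.
  exact: bigcupT_measurable.
have mB' := measurable_Rn_borel mB.
have mBE : measurable ((B : set (Rn R n)) `\` E') by exact: measurableD.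
have BE : vol ((B : set (Rn R n)) `\` E') a l <= e / 2.
  rewrite -lee_fin -volE//.
  apply: (@le_trans _ _ (mu ((B : set (Rn R n)) `\` E'))).
    by apply: le_measure; rewrite ?inE//; exact: measurableI.
  have := @measureDI _ _ _ mu _ _ mB' mE'.
  rewrite (setIidr EB) => eqB; move: muB; rewrite eqB addeC lteD2lE//.
  exact: ltW.
have [vmB vB] := vanishing_mixing_borel mB.
have e20 : 0 < e / 2 by rewrite divr_gt0.
have [N _ /(_ N (leqnn N))/= hN] := vB a l l0 _ e20.
exists N.
have mD : measurable (E `\` E') by exact: measurableD.
have h1 : mixing N E a l <= mixing N E' a l.
  have {1}-> : E = E' `|` (E `\` E') by rewrite setDUK//; exact: subIsetr.
  apply: (le_trans (mixingU _ _ _ mE' mD)); rewrite gerDl.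
  apply: (le_trans (mixing_le_vol _ _ mD l0)).
  rewrite /vol (_ : _ `&` _ = set0) ?measure0//.
  by apply/seteqP; split=> // x [Px [Ex]]; apply.
(* Mixing is subadditive under unions only; removing [B `\` E'] from [B]
   becomes a union after passing to complements. *)
have h2 : mixing N E' a l <= mixing N B a l + vol ((B : set (Rn R n)) `\` E') a l.
  rewrite -mixingC -(mixingC _ B).
  have -> : ~` E' = ~` B `|` ((B : set (Rn R n)) `\` E').
    apply/seteqP; split=> x.
      by move=> nE; have [Bx|nBx] := pselect (B x); [right|left].
    by move=> [nB /EB//|[]].
  apply: (le_trans (mixingU _ _ _ (measurableC mB') mBE)); rewrite lerD2l.
  exact: mixing_le_vol.
move: hN BE; lra.
Qed.

End mixing_vanishes.

(** * Growth of sets that absorb the cubes of high density *)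

Section growth.
Context {R : realType} {n : nat}.
Local Notation mu := (@lebesgueRn R n).
Implicit Types (a x : Rn R n) (l s t e lam : R) (E F : set (Rn R n)).
#[local] Hint Resolve measurable_hcube measurable_cube : core.

(** The cubes inscribed at one vertex go from the dense child to the sparse
    parent. Their side is increased in steps so small that the volume of the
    cube grows at most by the factor 2 / (1 + lam); the last dense cube is then
    the required one, because the next one is sparse and contains it. *)
Lemma intermediate_density E a l b lam : measurable E -> 0 < l ->
  0 < lam -> lam < 1 ->
  lam * (l / 2) ^+ n < vol E (corner a l (l / 2) b) (l / 2) ->
  vol E a l <= lam * l ^+ n ->
  exists s, [/\ l / 2 <= s, s <= l, lam * s ^+ n < vol E (corner a l s b) s &
    vol E (corner a l s b) s <= 2 * lam / (1 + lam) * s ^+ n].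
Proof.
move=> mE l0 lam0 lam1 hvy lgt.
(* [K] steps lead from side [l / 2] to side [l]; each multiplies the side by
   at most [1 + K^-1], and [n / K <= (1 - lam) / 2] keeps the [n]-th power of
   this factor below 2 / (1 + lam). *)
pose K := (Num.truncn (2 * n%:R / (1 - lam))).+1.
have K0 : 0 < K%:R :> R by rewrite ltr0n.
have Kn : n%:R / K%:R <= (1 - lam) / 2.
  have := truncnS_gt (2 * n%:R / (1 - lam)); rewrite -/K => h.
  have h1 : 2 * n%:R < K%:R * (1 - lam) by rewrite -ltr_pdivrMr// subr_gt0.
  by rewrite ler_pdivrMr//; move: h1; lra.
pose s k := l / 2 * (1 + k%:R / K%:R).
pose light k := vol E (corner a l (s k) b) (s k) <= lam * s k ^+ n.
have sK : s K = l by rewrite /s divff ?gt_eqF//; lra.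
have exlight : exists k, light k.
  by exists K; rewrite /light sK corner_full.
case: (ex_minnP exlight) => -[|k] kl kmin.
  by move: kl; rewrite /light/s mul0r addr0 mulr1 leNgt hvy.
have smono i j : (i <= j)%N -> s i <= s j.
  move=> ij; rewrite /s ler_wpM2l ?divr_ge0 ?(ltW l0)// lerD2l.
  by rewrite ler_wpM2r ?invr_ge0 ?ler_nat// ltW.
have skl : s k.+1 <= l.
  by rewrite -[leRHS]sK smono//; apply: kmin; rewrite /light sK corner_full.
have sk0 : l / 2 <= s k.
  by rewrite /s ler_peMr ?lerDl ?divr_ge0// ltW.
have sk1 : s k <= s k.+1.
  exact: smono.
exists (s k); split=> //.
- exact: le_trans skl.
- by rewrite ltNge; apply/negP => /kmin; rewrite ltnn.
apply: (@le_trans _ _ (lam * s k.+1 ^+ n)).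
  by apply: le_trans kl; apply: vol_sub => //; exact: corner_mono.
have K01 : 0 <= K%:R^-1 :> R by rewrite invr_ge0 ltW.
have le1 : s k.+1 <= s k * (1 + K%:R^-1).
  have -> : s k.+1 = s k + l / 2 * K%:R^-1.
    by rewrite /s -[k.+1%:R]natr1; ring.
  by rewrite mulrDr mulr1 lerD2l ler_wpM2r.
have s0 : 0 <= s k by apply: le_trans sk0; rewrite divr_ge0// ltW.
have le2 : s k.+1 ^+ n <= s k ^+ n * (1 + K%:R^-1) ^+ n.
  rewrite -exprMn; apply: lerXn2r => //; rewrite nnegrE.
    exact: le_trans sk1.
  by apply: mulr_ge0 => //; exact: addr_ge0.
have le3 : (1 + K%:R^-1) ^+ n * ((1 + lam) / 2) <= 1.
  have K1 : K%:R^-1 <= 1 :> R by rewrite invf_le1// ler1n.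
  apply: (@le_trans _ _ ((1 + K%:R^-1) ^+ n * (1 - K%:R^-1) ^+ n)).
    rewrite ler_wpM2l ?exprn_ge0 ?addr_ge0//.
    by apply: le_trans (bernoulli_le n K01 K1); move: Kn; lra.
  rewrite -exprMn exprn_ile1//.
    by apply: mulr_ge0; [exact: addr_ge0|rewrite subr_ge0].
  have : 0 <= K%:R^-1 * K%:R^-1 :> R by rewrite mulr_ge0.
  by lra.
have le4 : (1 + K%:R^-1) ^+ n <= 2 / (1 + lam).
  by rewrite ler_pdivlMr ?addr_gt0//; move: le3; lra.
apply: (le_trans (ler_wpM2l (ltW lam0) le2)).
rewrite [leLHS](_ : _ = lam * (1 + K%:R^-1) ^+ n * s k ^+ n); last by ring.
rewrite ler_wpM2r ?exprn_ge0//.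
rewrite [leRHS](_ : _ = lam * (2 / (1 + lam))); last by ring.
by rewrite ler_wpM2l// ltW.
Qed.

(** (1 - lam) / (1 + lam) = 1 - 2 lam / (1 + lam) is the share of the complement
    in the cubes of [intermediate_density], and such a cube fills at least
    2^-n of the parent cube. *)
Definition growth_gain lam : R := (1 - lam) / (1 + lam) / 2 ^+ n.

Lemma growth_gain_gt0 lam : 0 < lam -> lam < 1 -> 0 < growth_gain lam.
Proof.
by move=> lam0 lam1; rewrite /growth_gain !divr_gt0 ?subr_gt0 ?addr_gt0.
Qed.

(** What the median maximal operator guarantees for successive level sets
    [E] and [F]. *)
Definition absorbs_dense lam E F a l := forall a' l', 0 < l' ->
  hcube a' l' `<=` hcube a l -> lam * l' ^+ n < vol E a' l' ->
  vol (~` F) a' l' = 0.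

(** Induction on the generation [N]. For [N = 0], a cube [Q] of density at most
    [lam] satisfies |Q \ E| >= (1 - lam) |Q & E|, so its mixing is at least
    (1 - lam) |Q & E|. *)
Lemma growth_up_to_mixing lam E F a0 l0 (N : nat) a l :
  measurable E -> measurable F -> 0 < lam -> lam < 1 ->
  absorbs_dense lam E F a0 l0 ->
  0 < l -> hcube a l `<=` hcube a0 l0 -> vol E a l <= lam * l ^+ n ->
  growth_gain lam * vol E a l <=
    vol (F `&` ~` E) a l + growth_gain lam / (1 - lam) * mixing N E a l.
Proof.
move=> mE mF lam0 lam1 abs; set c := growth_gain lam.
have c0 : 0 < c by exact: growth_gain_gt0.
have lam10 : 0 < 1 - lam by rewrite subr_gt0.
have d0 : 0 < c / (1 - lam) by rewrite divr_gt0.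
have cd : c = c / (1 - lam) * (1 - lam) by rewrite divfK// gt_eqF.
have mFE : measurable (F `&` ~` E).
  by apply: measurableI => //; exact: measurableC.
elim: N a l => [|N IH] a l lgt0 sub light /=.
  rewrite -[leLHS]add0r lerD ?vol_ge0// {1}cd -mulrA ler_wpM2l ?(ltW d0)//.
  have := volC a mE lgt0; have v0 := vol_ge0 E a l.
  have lv : 0 <= lam * vol E a l by rewrite mulr_ge0// ltW.
  rewrite le_min => vC; apply/andP; split; first by move: lv; lra.
  have ll : lam * vol E a l <= lam * (lam * l ^+ n) by rewrite ler_wpM2l// ltW.
  have h : (1 - lam) * vol E a l <= (1 - lam) * (lam * l ^+ n).
    by rewrite ler_wpM2l// ltW.
  have h2 : (1 - lam) * (lam * l ^+ n) <= (1 - lam) * l ^+ n.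
    rewrite ler_wpM2l ?(ltW lam10)// ler_piMl ?exprn_ge0// ltW//.
  move: h h2 light vC; lra.
have l20 : 0 < l / 2 by rewrite divr_gt0.
have sub2 b : hcube (corner a l (l / 2) b) (l / 2) `<=` hcube a0 l0.
  by apply: subset_trans sub; apply: corner_sub; lra.
have [/existsP[b hb]|/existsPn nheavy] := boolP [exists b,
    lam * (l / 2) ^+ n < vol E (corner a l (l / 2) b) (l / 2)]; last first.
  rewrite !(vol_children a _ lgt0)// !mulr_sumr -big_split/=.
  apply: ler_sum => b _; apply: IH => //.
  by rewrite leNgt; exact: nheavy.
(* A dense child: the growth inside one intermediate cube already suffices
   for the whole cube. *)
have [s [ls sl dense dense']] := intermediate_density mE lgt0 lam0 lam1 hb light.
have s0 : 0 < s by exact: lt_le_trans ls.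
have subs : hcube (corner a l s b) s `<=` hcube a l by exact: corner_sub.
have F0 := abs _ _ s0 (subset_trans subs sub) dense.
have h1 := vol_sub mFE subs.
have h2 : vol (F `&` ~` E) (corner a l s b) s = s ^+ n - vol E (corner a l s b) s.
  have eq1 := volID (corner a l s b) s (measurableC mE) mF.
  have eq2 : vol (~` E `&` ~` F) (corner a l s b) s = 0.
    apply/eqP; rewrite eq_le vol_ge0 andbT -F0.
    apply: vol_le; last by move=> x [_ []].
    - by apply: measurableI; exact: measurableC.
    - exact: measurableC.
  have := volC (corner a l s b) mE s0.
  by rewrite (setIC F) eq1 eq2 addr0 => <-; rewrite [RHS]addrC addKr.
have h3 : c * vol E a l <= vol (F `&` ~` E) (corner a l s b) s.
  rewrite h2; apply: (@le_trans _ _ (c * l ^+ n)).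
    rewrite ler_wpM2l ?(ltW c0)//; apply: (le_trans light).
    by rewrite ler_piMl ?exprn_ge0// ltW.
  have -> : c * l ^+ n = (1 - lam) / (1 + lam) * (l / 2) ^+ n.
    by rewrite exprMn exprVn /c /growth_gain; ring.
  apply: (@le_trans _ _ ((1 - lam) / (1 + lam) * s ^+ n)).
    rewrite ler_wpM2l ?divr_ge0 ?(ltW lam10) ?addr_ge0 ?(ltW lam0)//.
    by rewrite lerXn2r// nnegrE ltW.
  have e1 : (1 - lam) / (1 + lam) = 1 - 2 * lam / (1 + lam).
    by field; rewrite gt_eqF// addr_gt0.
  by rewrite e1; move: dense'; lra.
apply: (le_trans h3); apply: (le_trans h1); rewrite lerDl.
apply: mulr_ge0; first exact: ltW.
by apply: sumr_ge0 => b' _; exact: mixing_ge0.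
Qed.

Lemma growth lam E F a l : measurable E -> measurable F ->
  0 < lam -> lam < 1 -> 0 < l -> E `<=` F -> absorbs_dense lam E F a l ->
  vol E a l <= lam * l ^+ n ->
  (1 + growth_gain lam) * vol E a l <= vol F a l.
Proof.
move=> mE mF lam0 lam1 l0 EF abs light.
have c0 := growth_gain_gt0 lam0 lam1.
have d0 : 0 < growth_gain lam / (1 - lam) by rewrite divr_gt0// subr_gt0.
rewrite (volID a l mF mE) (setIidr EF) mulrDl mul1r lerD2l.
apply/ler_addgt0Pr => e e0.
have [N hN] := mixing_cvg0 a mE l0 (divr_gt0 e0 d0).
apply: (le_trans (growth_up_to_mixing N mE mF lam0 lam1 abs l0 _ light)) => //.
by rewrite lerD2l mulrC -ler_pdivlMr// ltW.
Qed.

End growth.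

(** * Level sets of the iterated median maximal operator *)

Section level_sets.
Context d (T : measurableType d) (R : realType).
Implicit Types (v : T -> R) (b : R).

Lemma measurable_ge_level v b : measurable_fun setT v ->
  measurable [set y | b <= v y].
Proof.
move=> mv; rewrite (_ : mkset _ = setT `&` v @^-1` `[b, +oo[); first exact: mv.
by rewrite setTI; apply/seteqP; split=> y /=; rewrite in_itv/= andbT.
Qed.

Lemma measurable_gt_level v b : measurable_fun setT v ->
  measurable [set y | b < v y].
Proof.
move=> mv; rewrite (_ : mkset _ = setT `&` v @^-1` `]b, +oo[); first exact: mv.
by rewrite setTI; apply/seteqP; split=> y /=; rewrite in_itv/= andbT.
Qed.

Lemma measurable_normr_fun v : measurable_fun setT v ->
  measurable_fun setT (fun y => `|v y|).
Proof. by move=> mv; exact: (measurableT_comp (@normr_measurable R setT)). Qed.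

End level_sets.

Section median.
Context {R : realType} {n : nat}.
Local Notation mu := (@lebesgueRn R n).
Implicit Types (a x : Rn R n) (l s t e lam : R) (E F : set (Rn R n)).
#[local] Hint Resolve measurable_hcube measurable_cube : core.

Lemma median_maximal_ge lam (v : Rn R n -> R) al a l x :
  measurable_fun setT v -> 0 < al -> 0 < l -> cube a l x ->
  lam * l ^+ n < vol [set y | al <= v y] a l ->
  (al%:E <= median_maximal lam v x)%E.
Proof.
move=> mv al0 l0 Qx dense.
apply: (@le_trans _ _
  (rearrangement (v \* \1_(cube a l)) (lam%:E * mu (cube a l)))); last first.
  by apply: ereal_sup_ubound; exists (cube a l) => //; split=> //; exists a, l.
apply: le_ereal_inf_tmp => _ [b [b0 hb] <-]; rewrite lee_fin leNgt; apply/negP => bal.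
move: hb; apply/negP; rewrite -ltNge lebesgueRn_cube ?ltW// -EFinM.
have mE : measurable [set y | al <= v y].
  exact: measurable_ge_level.
apply: (@lt_le_trans _ _ (vol [set y | al <= v y] a l)%:E); first by rewrite lte_fin.
rewrite -volE//; apply: le_measure; rewrite ?inE; first exact: measurableI.
  apply: measurable_gt_level; apply: measurable_normr_fun.
  by apply: measurable_funM => //; exact: measurable_indic.
move=> y [Py /= aly]; rewrite indicE mem_set ?mulr1; last exact: hcube_sub_cube.
by rewrite (lt_le_trans bal)// (le_trans aly)// ler_norm.
Qed.

Variables (lam : R) (u : nat -> Rn R n -> R).
Hypotheses (lam0 : 0 < lam) (lam1 : lam < 1).
Hypothesis mes_u : forall k, measurable_fun setT (u k).
Hypothesis u0 : forall y, 0 <= u 0 y.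
Hypothesis uS : forall k y,
  u k.+1 y = u k y + fine (median_maximal lam (u k) y).
Hypothesis fin_median : {ae mu, forall y, forall k,
  median_maximal lam (u k) y \is a fin_num}.

Lemma median_maximal_ge0 (v : Rn R n -> R) x : (0 <= median_maximal lam v x)%E.
Proof.
apply: (@le_trans _ _ (rearrangement (v \* \1_(cube x 1)) (lam%:E * mu (cube x 1)))).
  by apply: le_ereal_inf_tmp => _ [b [b0 hb] <-]; rewrite lee_fin ltW.
apply: ereal_sup_ubound; exists (cube x 1) => //; split; first by exists x, 1.
by move=> i; rewrite lexx/= lerDl.
Qed.

Let u_ge0 k y : 0 <= u k y.
Proof.
elim: k => // k IH; rewrite uS addr_ge0//.
exact/fine_ge0/median_maximal_ge0.
Qed.

Let u_le i k y : (i <= k)%N -> u i y <= u k y.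
Proof.
elim: k => [|k IH]; first by rewrite leqn0 => /eqP ->.
rewrite leq_eqVlt => /predU1P[->//|]; rewrite ltnS => /IH h.
by rewrite uS (le_trans h)// lerDl fine_ge0// median_maximal_ge0.
Qed.

Let measurable_level k al : measurable [set y | al <= u k y].
Proof. exact: measurable_ge_level. Qed.

Let absorbs_dense_level k al a l : 0 < al ->
  absorbs_dense lam [set y | al <= u k y] [set y | al <= u k.+1 y] a l.
Proof.
move=> al0 a' l' l'0 _ dense; have [A [mA A0 sA]] := fin_median.
apply/eqP; rewrite eq_le vol_ge0 andbT -lee_fin -volE; last exact: measurableC.
apply: (@le_trans _ _ (mu A)); last by rewrite A0.
apply: le_measure; rewrite ?inE//.
  by apply: measurableI => //; exact: measurableC.
move=> y [Py /= nal]; apply: sA => /= /(_ k) fy; apply: nal.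
have := median_maximal_ge (mes_u k) al0 l'0 (hcube_sub_cube Py) dense.
by rewrite -(fineK fy) lee_fin uS => h; rewrite (le_trans h)// lerDr.
Qed.

(** While the level set of [u i] has density at most [lam] in the cube, the next
    one is larger by the growth factor; once its density exceeds [lam], the
    median maximal function is at least [al] at every point of the cube. *)
Lemma median_iterates_ge k al a l x :
  (forall k, median_maximal lam (u k) x \is a fin_num) ->
  0 < al -> 0 < l -> cube a l x ->
  lam * l ^+ n < (1 + @growth_gain R n lam) ^+ k * vol [set y | al <= u 0 y] a l ->
  al <= u k.+1 x.
Proof.
move=> fx al0 l0 Qx.
have th0 : 0 < 1 + @growth_gain R n lam by rewrite addr_gt0// growth_gain_gt0.
suff gen i : lam * l ^+ n <
    (1 + @growth_gain R n lam) ^+ k * vol [set y | al <= u i y] a l ->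
    al <= u (i + k.+1)%N x by exact: gen.
have last j : lam * l ^+ n < vol [set y | al <= u j y] a l -> al <= u j.+1 x.
  move=> /(median_maximal_ge (mes_u j) al0 l0 Qx).
  by rewrite -(fineK (fx j)) lee_fin uS => h; rewrite (le_trans h)// lerDr.
elim: k i => [|k IH] i; first by rewrite expr0 mul1r addn1; exact: last.
move=> h; have [light|/last ui] := leP (vol [set y | al <= u i y] a l) (lam * l ^+ n).
  rewrite addnS -addSn; apply: IH; apply: (lt_le_trans h).
  rewrite exprSr -mulrA ler_wpM2l ?exprn_ge0 ?(ltW th0)//.
  apply: (growth (measurable_level i al) (measurable_level i.+1 al)) => //.
  - by move=> y /= /le_trans; apply; exact: u_le.
  - exact: absorbs_dense_level.
by apply: (le_trans ui); apply: u_le; rewrite addnS ltnS leq_addr.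
Qed.

End median.

(** * Averages of functions with geometrically decaying level sets *)

Section layer_cake.
Context d (T : measurableType d) (R : realType).
Variable mu : {measure set T -> \bar R}.

Lemma expr_unbounded (B y : R) : 1 < B -> exists k : nat, y < B ^+ k.
Proof.
move=> B1; have B10 : 0 < B - 1 by rewrite subr_gt0.
have bern k : 1 + k%:R * (B - 1) <= B ^+ k.
  elim: k => [|k IH]; first by rewrite mul0r addr0 expr0.
  have h : (1 + k%:R * (B - 1)) * B <= B ^+ k.+1.
    by rewrite exprSr ler_wpM2r//; lra.
  apply: le_trans h; rewrite -natr1.
  have : 0 <= k%:R * (B - 1) * (B - 1) by rewrite !mulr_ge0// ltW.
  by lra.
exists (Num.truncn (y / (B - 1))).+1; apply: lt_le_trans (bern _).
have := truncnS_gt (y / (B - 1)); rewrite ltr_pdivrMr//; lra.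
Qed.

(** On {B^(k+1) s <= |f| < B^(k+2) s} the function is at most B^(k+2) s, and the
    measure of this set is at most M th^-k, so the integral is bounded by a
    geometric series of ratio B / th < 1. *)
Lemma integral_normr_geometric (D : set T) (f : T -> R) (B th s M : R) :
  measurable D -> measurable_fun setT f -> 1 < B -> B < th -> 0 < s ->
  (mu D <= M%:E)%E ->
  (forall k, mu ([set y | (B ^+ k.+1 * s <= `|f y|)%R] `&` D) <= (M / th ^+ k)%:E)%E ->
  (\int[mu]_(y in D) `|f y|%:E <= (s * M * (B + B ^+ 2 / (1 - B / th)))%:E)%E.
Proof.
move=> mD mf B1 Bth s0 muD tail.
have B0 : 0 < B by exact: lt_trans B1.
have th0 : 0 < th by exact: lt_trans Bth.
have M0 : 0 <= M by rewrite -lee_fin (le_trans _ muD)// measure_ge0.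
have q1 : B / th < 1 by rewrite ltr_pdivrMr// mul1r.
pose A k := [set y | B ^+ k.+1 * s <= `|f y|].
have mA k : measurable (A k).
  by apply: measurable_ge_level; exact: measurable_normr_fun.
pose g k y := (B ^+ k.+2 * s * \1_(A k) y)%:E.
have c0 k : 0 <= B ^+ k * s by rewrite mulr_ge0// ?exprn_ge0// ltW.
have g0 k y : (0 <= g k y)%E by rewrite lee_fin mulr_ge0.
have mg k : measurable_fun D (g k).
  by apply/measurable_EFinP; apply: measurable_funM.
have sg0 y : (0 <= \sum_(0 <= k <oo) g k y)%E by exact: nneseries_ge0.
have pointwise y : (`|f y|%:E <= (B * s)%:E + \sum_(0 <= k <oo) g k y)%E.
  have [k0 hk0] := expr_unbounded (`|f y| / s) B1.
  have exk : exists k, `|f y| < B ^+ k * s.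
    by exists k0; rewrite -ltr_pdivrMr.
  case: (ex_minnP exk) => k hk kmin.
  have [k1|k2] := leqP k 1.
    rewrite -[leLHS]adde0; apply: leeD => //; rewrite lee_fin ltW//.
    apply: (lt_le_trans hk); rewrite ler_wpM2r ?(ltW s0)//.
    by rewrite -[leRHS]expr1 ler_eXn2l.
  case: k k2 hk kmin => [//|[//|j]] _ hk kmin.
  have jA : A j y.
    by rewrite /A/= leNgt; apply/negP => /kmin; rewrite ltnn.
  rewrite -[leLHS]add0e; apply: leeD; first by rewrite lee_fin mulr_ge0// ltW.
  apply: le_trans (nneseries_lim_ge j.+1 (fun k _ _ => g0 k y)).
  rewrite big_nat_recr//= -[leLHS]add0e; apply: leeD.
    by apply: sume_ge0 => k _.
  by rewrite lee_fin indicE mem_set// mulr1 ltW.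
have msum : measurable_fun D (fun y => \sum_(0 <= k <oo) g k y)%E.
  exact: (@ge0_emeasurable_sum _ _ _ D g xpredT).
apply: (@le_trans _ _ (\int[mu]_(y in D) ((B * s)%:E + \sum_(0 <= k <oo) g k y))%E).
  apply: ge0_le_integral => //.
  - by apply/measurable_EFinP/measurable_funTS/measurable_normr_fun.
  - exact: emeasurable_funD.
rewrite ge0_integralD//; last by move=> y _; rewrite lee_fin mulr_ge0// ltW.
rewrite integral_nneseries// [X in (X + _)%E]integral_cst//.
have intg k : (\int[mu]_(y in D) g k y <= (s * M * B ^+ 2 * (B / th) ^+ k)%:E)%E.
  rewrite /g; under eq_integral do rewrite EFinM.
  rewrite ge0_integralZl_EFin//; last first.
    by apply/measurable_EFinP; exact: measurable_indic.
  rewrite integral_indic//.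
  apply: (le_trans (lee_wpmul2l _ (tail k))); first by rewrite lee_fin.
  rewrite -EFinM lee_fin le_eqVlt; apply/orP; left; apply/eqP.
  by rewrite exprMn exprVn 2!exprS expr2; ring.
have -> : s * M * (B + B ^+ 2 / (1 - B / th)) =
  B * s * M + s * M * B ^+ 2 / (1 - B / th) by ring.
rewrite EFinD; apply: leeD.
  rewrite (EFinM (B * s)); apply: lee_wpmul2l => //.
  by rewrite lee_fin mulr_ge0// ltW.
apply: lime_le; first by apply: is_cvg_nneseries => k _ _; exact: integral_ge0.
apply: nearW => m.
apply: (@le_trans _ _ (\sum_(0 <= k < m) (s * M * B ^+ 2 * (B / th) ^+ k)%:E)%E).
  by apply: lee_sum => k _; exact: intg.
rewrite sumEFin lee_fin -mulr_sumr big_mkord ler_wpM2l//.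
  by rewrite !mulr_ge0// ?exprn_ge0 ltW.
rewrite -[leRHS]mul1r ler_pdivlMr ?subr_gt0//.
have := subrX1 (B / th) m.
have : 0 <= (B / th) ^+ m by rewrite exprn_ge0// divr_ge0// ltW.
by rewrite mulrC; lra.
Qed.

End layer_cake.

(** * Measurability of the Hardy-Littlewood maximal function *)

Section hardy_littlewood_measurable.
Context {R : realType} {n : nat}.
Local Notation mu := (@lebesgueRn R n).
Implicit Types (a x : Rn R n) (l s t e : R).
#[local] Hint Resolve measurable_hcube measurable_cube : core.

Definition ratpoint (q : n.-tuple rat) : Rn R n := [tuple ratr (tnth q i) | i < n].

Lemma average_enlarge (I : \bar R) l t : (0 <= I)%E -> 0 < l ->
  (t%:E < (l ^+ n)^-1%:E * I)%E ->
  exists2 e, 0 < e & forall l', l < l' -> l' < l + e ->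
    (t%:E < (l' ^+ n)^-1%:E * I)%E.
Proof.
move=> I0 l0; case: I I0 => [I I0| _ _|//]; last first.
  exists 1 => // l' ll' _; have l'0 : 0 < l' by exact: lt_trans ll'.
  by rewrite mulry gtr0_sg ?invr_gt0 ?exprn_gt0// mul1e ltry.
rewrite -EFinM lte_fin => h.
have cv : (x ^+ n)^-1 * I @[x --> l] --> (l ^+ n)^-1 * I.
  apply: cvgMl; apply: cvgV; first by rewrite expf_neq0// gt_eqF.
  exact: exprn_continuous.
have /(_ _) := cvgr_gt _ cv _ h.
move=> [e/= e0 he]; exists e => // l' ll' l'e.
rewrite -EFinM lte_fin; apply: he => /=.
by rewrite ltr0_norm ?subr_lt0//; lra.
Qed.

Lemma rational_cube_above a l e : 0 < l -> 0 < e ->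
  exists q : n.-tuple rat * rat,
    [/\ cube a l `<=` cube (ratpoint q.1) (ratr q.2),
        l < ratr q.2 & ratr q.2 < l + e].
Proof.
move=> l0 e0.
have /(_ _)/cid h (i : 'I_n) : exists q : rat, ratr q \in `]tnth a i - e / 2, tnth a i[.
  by apply: rat_in_itvoo; rewrite ltrBlDr ltrDl divr_gt0.
have [r] : exists q : rat, ratr q \in `]l + e / 2, l + e[.
  by apply: rat_in_itvoo; lra.
rewrite in_itv/= => /andP[r1 r2].
exists ([tuple sval (h i) | i < n], r); split => //=; last by lra.
move=> x H i; have /andP[h1 h2] := H i.
rewrite !tnth_mktuple; have := svalP (h i); rewrite in_itv/= => /andP[h3 h4].
by apply/andP; split; lra.
Qed.

(** A cube whose average exceeds [t] is contained in a slightly larger rational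
    cube whose average still exceeds [t], so {t < Mf} is a countable union of
    cubes. *)
Lemma measurable_hardy_littlewood (f : Rn R n -> R) :
  measurable_fun setT f -> measurable_fun setT (hardy_littlewood f).
Proof.
move=> mf; apply: (measurability _ (ErealGenOInfty.measurableE R)) => //.
move=> _ [_ [t ->] <-]; rewrite setTI.
pose Q (q : n.-tuple rat * rat) := cube (ratpoint q.1) (ratr q.2).
pose J := [set q : n.-tuple rat * rat | 0 < ratr q.2 :> R /\
  (t%:E < (mu (Q q))^-1 * \int[mu]_(y in Q q) `|f y|%:E)%E].
rewrite (_ : _ @^-1` _ = \bigcup_(q in J) Q q).
  rewrite bigcup_mkcond; apply: countable_bigcupT_measurable => [|q].
    exact: countableP.
  by case: ifP => _; [exact: measurable_cube|exact: measurable0].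
apply/seteqP; split=> x /=.
  rewrite in_itv/= andbT => /ereal_sup_gt[_ [_ [[a [l [l0 ->]]] Qx] <-] lt].
  have I0 : (0 <= \int[mu]_(y in cube a l) `|f y|%:E)%E by exact: integral_ge0.
  move: lt; rewrite lebesgueRn_cube ?ltW// inver gt_eqF ?exprn_gt0// => lt.
  have [e e0 he] := average_enlarge I0 l0 lt.
  have [q [sub lq qe]] := rational_cube_above a l0 e0.
  have q0 : 0 < ratr q.2 :> R by exact: lt_trans lq.
  exists q; last exact: sub.
  split=> //; rewrite lebesgueRn_cube ?ltW// inver gt_eqF ?exprn_gt0//.
  apply: (lt_le_trans (he _ lq qe)); apply: lee_wpmul2l.
    by rewrite lee_fin invr_ge0 exprn_ge0// ltW.
  have mnf : measurable_fun (Q q) (fun y => `|f y|%:E).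
    exact/measurable_EFinP/measurable_funTS/measurable_normr_fun.
  have nf0 y : Q q y -> (0 <= `|f y|%:E)%E by rewrite lee_fin.
  exact: (ge0_subset_integral _ (measurable_cube a l) (measurable_cube _ _) mnf nf0 sub).
move=> [q [q0 tq] Qx]; rewrite in_itv/= andbT; apply: (lt_le_trans tq).
apply: ereal_sup_ubound; exists (Q q) => //; split=> //.
by exists (ratpoint q.1), (ratr q.2).
Qed.

End hardy_littlewood_measurable.

(** * Majorants in a Banach function space *)

Section banach_function_space_series.
Context {R : realType} {n : nat} (X : fun_space R n).
Hypothesis bfsX : banach_function_space X.
Local Notation mu := (@lebesgueRn R n).

Lemma bfs_sum (w : nat -> Rn R n -> R) N : (forall k, X (w k)) ->
  X (fun x => \sum_(k < N) w k x) /\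
  fnorm X (fun x => \sum_(k < N) w k x) <= \sum_(k < N) fnorm X (w k).
Proof.
move=> Xw; elim: N => [|N [XS nS]].
  rewrite (_ : (fun _ => _) = cst 0); last by apply/funext => x; rewrite big_ord0.
  split; first exact: bfs0.
  rewrite big_ord0 (_ : cst 0 = (fun x : Rn R n => 0 * cst 0 x)).
    by rewrite bfs_normZ ?normr0 ?mul0r//; exact: bfs0.
  by apply/funext => x; rewrite mul0r.
rewrite (_ : (fun _ => _) = (fun x => \sum_(k < N) w k x) \+ w N).
  split; first exact: bfsD.
  by rewrite big_ord_recr/=; apply: (le_trans (bfs_normD _ _ _)) => //; rewrite lerD2r.
by apply/funext => x; rewrite big_ord_recr.
Qed.

Variables (w : nat -> Rn R n -> R) (A : R).
Hypothesis Xw : forall k, X (w k).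
Hypothesis w0 : forall k x, 0 <= w k x.
Hypothesis wA : forall k, fnorm X (w k) <= 2 ^- k * A.

Let S (N : nat) (x : Rn R n) := \sum_(k < N) w k x.
Let Ge (x : Rn R n) : \bar R := (\sum_(0 <= k <oo) (w k x)%:E)%E.

Let XS N : X (S N). Proof. by have [] := bfs_sum N Xw. Qed.

Let normS N : fnorm X (S N) <= 2 * A.
Proof.
have A0 : 0 <= A.
  by have := le_trans (bfs_norm_ge0 bfsX (Xw 0)) (wA 0); rewrite expr0 invr1 mul1r.
have [_ h] := bfs_sum N Xw; apply: (le_trans h).
apply: (@le_trans _ _ (\sum_(k < N) 2 ^- k * A)); first exact: ler_sum.
rewrite -mulr_suml ler_wpM2r//; under eq_bigr do rewrite -exprVn.
have := subrX1 (2^-1 : R) N; have : 0 <= (2^-1 : R) ^+ N by rewrite exprn_ge0.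
by lra.
Qed.

Let S_nd x : nondecreasing_seq (S ^~ x).
Proof. by apply/nondecreasing_seqP => k; rewrite /S big_ord_recr lerDl. Qed.

Let S0 N x : 0 <= S N x. Proof. exact: sumr_ge0. Qed.

Let cvg_S x : ((S N x)%:E @[N --> \oo] --> Ge x)%E.
Proof.
rewrite (_ : (fun _ => _) = (fun N => \sum_(0 <= k < N) (w k x)%:E)%E).
  by apply: is_cvg_nneseries => k _ _; rewrite lee_fin.
by apply/funext => N; rewrite /S sumEFin big_mkord.
Qed.

Let mw k : measurable_fun setT (w k). Proof. exact: (bfs_measurable bfsX). Qed.

Let mGe : measurable_fun setT Ge.
Proof.
have h0 k x : setT x -> xpredT k -> (0 <= (w k x)%:E)%E by rewrite lee_fin.
have h1 k : xpredT k -> measurable_fun setT (EFin \o w k).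
  by move=> _; exact/measurable_EFinP.
exact: (@ge0_emeasurable_sum _ _ _ setT (fun k x => (w k x)%:E) xpredT h0 h1).
Qed.

Let Ge0 x : (0 <= Ge x)%E.
Proof. by apply: nneseries_ge0 => k _ _; rewrite lee_fin. Qed.

(** Otherwise the sum would be infinite on a set of positive measure, which by
   saturation contains some [F] with [X \1_F]. Truncating the partial sums at
   height [K] on [F], the Fatou property gives [K * fnorm X \1_F <= 2 * A] for
   all [K], whence \1_F is null. *)
Let Ge_fin : {ae mu, forall x, Ge x \is a fin_num}.
Proof.
pose E := Ge @^-1` [set +oo%E].
have mE : measurable E by rewrite -[E]setTI; apply: mGe => //; exact: emeasurable_set1.
exists E; split=> //; last first.
  by move=> x /= /negP; rewrite ge0_fin_numE// -leNgt leye_eq => /eqP.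
have [//|E0] := eqVneq (mu E) 0; exfalso.
have Egt : (0 < mu E)%E by rewrite lt0e E0 measure_ge0.
have [F [mF FE F0 XF]] := bfs_saturation bfsX mE Egt.
have bound (K : nat) : K%:R * fnorm X \1_F <= 2 * A.
  pose v N x := Num.min (S N x) K%:R * \1_F x.
  have v_le N x : `|v N x| <= `|S N x|.
    rewrite !ger0_norm// ?mulr_ge0 ?le_min ?S0 ?ler0n//.
    by rewrite /v indicE; case: (_ \in _); rewrite ?mulr1 ?mulr0// ge_min lexx.
  have mv N : measurable_fun setT (v N).
    have mS : measurable_fun setT (S N) by exact: (bfs_measurable bfsX).
    have mK : measurable_fun setT (cst K%:R : Rn R n -> R).
      exact: measurable_cst.
    apply: measurable_funM; first exact: (measurable_minr mS mK).
    exact: measurable_indic.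
  have Xv N : X (v N) /\ fnorm X (v N) <= fnorm X (S N).
    by apply: (bfs_ideal bfsX) => //; exact: aeW.
  have ubv : ubound (range (fnorm X \o v)) (2 * A).
    by move=> _ [N _ <-]; exact: le_trans (Xv N).2 (normS N).
  have [||||_ nK] := bfs_fatou bfsX (u := v) (f := fun x => K%:R * \1_F x).
  - by move=> N; have [] := Xv N.
  - have mK : measurable_fun setT (cst K%:R : Rn R n -> R).
      exact: measurable_cst.
    by apply: measurable_funM; [exact: mK|exact: measurable_indic].
  - apply: aeW => x; split.
    + by move=> N; rewrite mulr_ge0// le_min S0 ler0n.
    + move=> i j ij; rewrite /v ler_wpM2r// le_min !ge_min lexx orbT andbT.
      by rewrite S_nd.
    + rewrite /v indicE; have [xF|] := boolP (x \in F); last first.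
        by move=> _; under eq_fun do rewrite mulr0; rewrite mulr0; exact: cvg_cst.
      have Ex : Ge x = +oo%E by apply: FE; rewrite inE in xF.
      apply: cvgMl; apply: cvg_near_cst.
      have := @cvg_S x; rewrite Ex => /cvgeyPge/(_ K%:R).
      by apply: filterS => N; rewrite lee_fin => h; apply/min_idPr.
  - by exists (2 * A).
  have := bfs_normZ bfsX K%:R XF; rewrite ger0_norm// => <-; rewrite nK.
  by apply: ge_sup => //; exists (fnorm X (v 0)); exists 0%N.
have nF0 : fnorm X \1_F = 0.
  apply/eqP; rewrite eq_le bfs_norm_ge0// andbT leNgt; apply/negP => nF.
  have := bound (Num.truncn (2 * A / fnorm X \1_F)).+1; apply/negP; rewrite -ltNge.
  by rewrite -ltr_pdivrMr// truncnS_gt.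
have [N [mN N0 sN]] := bfs_norm_eq0 bfsX XF nF0.
have : (mu F <= mu N)%E.
  apply: le_measure; rewrite ?inE// => x Fx; apply: sN => /=.
  by rewrite indicE mem_set//; apply/eqP; rewrite oner_eq0.
by rewrite N0 leNgt F0.
Qed.

(** The majorant is the sum of the series. The Fatou property speaks of real
    valued limits, so the sum must first be shown finite almost everywhere. *)
Lemma bfs_dominate_series : exists G : Rn R n -> R,
  [/\ X G, fnorm X G <= 2 * A & {ae mu, forall x, forall k, w k x <= G x}].
Proof.
have mG : measurable_fun setT (fine \o Ge).
  exact: (measurableT_comp (fine_measurable measurableT)).
have cvgG : {ae mu, forall x, S N x @[N --> \oo] --> (fine \o Ge) x}.
  apply: filterS Ge_fin => x fx; have := @cvg_S x; rewrite -(fineK fx).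
  by move/fine_cvgP => [].
have [||||XG nG] := bfs_fatou bfsX (u := S) (f := fine \o Ge).
- exact: XS.
- exact: mG.
- by apply: filterS cvgG => x cx; split => //; exact: S_nd.
- by exists (2 * A) => _ [N _ <-]; exact: normS.
exists (fine \o Ge); split=> //.
  rewrite nG; apply: ge_sup; first by exists (fnorm X (S 0)); exists 0%N.
  by move=> _ [N _ <-]; exact: normS.
apply: filterS cvgG => x cx k.
apply: (@le_trans _ _ (S k.+1 x)); first by rewrite /S big_ord_recr/= lerDr sumr_ge0.
rewrite -(cvg_lim _ cx)//; apply: nondecreasing_cvgn_le; first exact: S_nd.
by apply/cvg_ex; exists ((fine \o Ge) x).
Qed.

End banach_function_space_series.

(** * From the median to the Hardy-Littlewood maximal operator *)

Section maximal_bound.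
Context {R : realType} {n : nat}.
Local Notation mu := (@lebesgueRn R n).
#[local] Hint Resolve measurable_hcube measurable_cube : core.

Lemma mu_cubeI (A : set (Rn R n)) a l : measurable A -> 0 < l ->
  mu (A `&` cube a l) = (vol A a l)%:E.
Proof.
move=> mA l0; rewrite -volE//; apply/eqP; rewrite eq_le; apply/andP; split.
  apply: (@le_trans _ _ (mu (hcube a l `&` A) + mu (cube a l `\` hcube a l))%E).
    apply: le_trans (measureU2 _ _ _) => //; last 2 first.
    - exact: measurableI.
    - exact: measurableD.
    apply: le_measure; rewrite ?inE//.
    - exact: measurableI.
    - by apply: measurableU; [exact: measurableI|exact: measurableD].
    move=> x [Ax Qx]; have [Px|nPx] := pselect (hcube a l x); first by left.
    by right.
  suff -> : (mu (cube a l `\` hcube a l) = 0)%E by rewrite adde0.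
  have Qfin : (mu (cube a l) < +oo)%E by rewrite lebesgueRn_cube ?ltry// ltW.
  have -> : (mu (cube a l `\` hcube a l) = mu (cube a l) - mu (cube a l `&` hcube a l))%E.
    exact: (@measureD _ _ _ mu _ _ (measurable_cube a l) (measurable_hcube a l) Qfin).
  rewrite (setIidr (@hcube_sub_cube _ _ a l)) lebesgueRn_cube ?ltW//.
  by rewrite lebesgueRn_hcube// subee.
apply: le_measure; rewrite ?inE//; [exact: measurableI|exact: measurableI|].
by move=> x [Px Ax]; split => //; exact: hcube_sub_cube.
Qed.

Variables (lam : R) (m : nat) (f : Rn R n -> R) (u : nat -> Rn R n -> R).
Hypotheses (lam0 : 0 < lam) (lam1 : lam < 1) (m0 : (0 < m)%N).
Hypothesis mf : measurable_fun setT f.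
Hypothesis mes_u : forall k, measurable_fun setT (u k).
Hypothesis uE : forall y, u 0 y = `|f y| ^+ m.
Hypothesis uS : forall k y,
  u k.+1 y = u k y + fine (median_maximal lam (u k) y).
Hypothesis fin_median : {ae mu, forall y, forall k,
  median_maximal lam (u k) y \is a fin_num}.

Let th : R := 1 + @growth_gain R n lam.
Variables (B D : R).
Hypotheses (B1 : 1 < B) (Bth : B < th) (D0 : 0 < D) (DB : D <= B ^+ m).

(** The constant of [integral_normr_geometric]. *)
Definition maximal_constant : R := B + B ^+ 2 / (1 - B / th).

Lemma maximal_constant_gt0 : 0 < maximal_constant.
Proof.
have B0 : 0 < B by exact: lt_trans B1.
rewrite addr_gt0// divr_gt0 ?exprn_gt0// subr_gt0 ltr_pdivrMr ?mul1r//.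
exact: lt_trans Bth.
Qed.

(** If |f| >= B^(k+1) s on more than the fraction th^-k of a cube containing
    [x], then u_(k+1)(x) >= (B^(k+1) s)^m > D^(k+1) G, against the choice of
    [G]. *)
Lemma hardy_littlewood_le (G s : R) x :
  (forall k, median_maximal lam (u k) x \is a fin_num) ->
  (forall k, D ^- k * u k x <= G) ->
  0 < s -> G < s ^+ m ->
  (hardy_littlewood f x <= (s * maximal_constant)%:E)%E.
Proof.
move=> fx uG s0 Gs; have B0 : 0 < B by exact: lt_trans B1.
have th0 : 0 < th by exact: lt_trans Bth.
have u00 y : 0 <= u 0 y by rewrite uE exprn_ge0.
apply: ge_ereal_sup => _ [_ [[a [l [l0 ->]]] Qx] <-].
have ln0 : 0 < l ^+ n by rewrite exprn_gt0.
have -> : (s * maximal_constant)%:E =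
    ((mu (cube a l))^-1 * (s * l ^+ n * maximal_constant)%:E)%E.
  rewrite lebesgueRn_cube ?ltW// inver gt_eqF// -EFinM; congr EFin.
  by rewrite (mulrC s (l ^+ n)) -mulrA mulKf ?gt_eqF.
apply: lee_wpmul2l; first by rewrite inve_ge0.
have muQ : (mu (cube a l) <= (l ^+ n)%:E)%E by rewrite lebesgueRn_cube// ltW.
apply: (integral_normr_geometric (measurable_cube a l) mf B1 Bth s0 muQ).
move=> k; set A := mkset _.
suff : (mu (A `&` cube a l) <= (l ^+ n / th ^+ k)%:E)%E by [].
have mA : measurable A.
  by apply: measurable_ge_level; exact: measurable_normr_fun.
rewrite mu_cubeI// lee_fin ler_pdivlMr ?exprn_gt0// leNgt; apply/negP => big.
have Bs0 : 0 < B ^+ k.+1 * s by rewrite mulr_gt0// exprn_gt0.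
have AE : A = [set y | (B ^+ k.+1 * s) ^+ m <= u 0 y].
  apply/seteqP; split=> y; by rewrite /A/= uE ler_pXn2r ?nnegrE ?(ltW Bs0).
have : (B ^+ k.+1 * s) ^+ m <= u k.+1 x.
  apply: (median_iterates_ge lam0 lam1 mes_u u00 uS fin_median fx _ l0 Qx).
    by rewrite exprn_gt0.
  rewrite -AE; apply: le_lt_trans (_ : l ^+ n < _).
    by rewrite ger_pMl// ltW.
  by rewrite mulrC.
have Dk : 0 < D ^+ k.+1 by rewrite exprn_gt0.
have := uG k.+1; rewrite mulrC ler_pdivrMr// => uk ule.
have := le_trans ule uk; apply/negP; rewrite -ltNge.
apply: (@lt_le_trans _ _ (s ^+ m * D ^+ k.+1)); first by rewrite ltr_pM2r.
rewrite exprMn mulrC ler_wpM2r ?exprn_ge0 ?(ltW s0)//.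
by rewrite -exprM mulnC exprM lerXn2r// nnegrE ?exprn_ge0// ltW.
Qed.

Lemma hardy_littlewood_pow_le (G : R) x :
  (forall k, median_maximal lam (u k) x \is a fin_num) ->
  (forall k, D ^- k * u k x <= G) ->
  hardy_littlewood f x \is a fin_num /\
  `|fine (hardy_littlewood f x)| ^+ m <= maximal_constant ^+ m * G.
Proof.
move=> fx uG; have K0 := maximal_constant_gt0.
have G0 : 0 <= G.
  by have := uG 0; rewrite expr0 invr1 mul1r uE; apply: le_trans; exact: exprn_ge0.
pose t := G `^ m%:R^-1.
have tm : t ^+ m = G.
  by rewrite -powR_mulrn ?powR_ge0// -powRrM mulVf ?powRr1// pnatr_eq0 -lt0n.
(* [hardy_littlewood_le] requires [G < s ^+ m] strictly, hence the passage to
   the limit [s -> t] below. *)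
have le_t s : t < s -> (hardy_littlewood f x <= (s * maximal_constant)%:E)%E.
  move=> ts; have s0 : 0 < s by apply: le_lt_trans ts; exact: powR_ge0.
  apply: hardy_littlewood_le => //; rewrite -tm ltrXn2r// ?nnegrE ?powR_ge0 ?ltW//.
  by rewrite -lt0n.
have hl0 : (0 <= hardy_littlewood f x)%E.
  have q : is_cube (cube x 1) /\ cube x 1 x.
    by split; [exists x, 1|move=> i; rewrite lexx/= lerDl].
  apply: (@le_trans _ _ ((mu (cube x 1))^-1 * \int[mu]_(y in cube x 1) `|f y|%:E)%E).
    by rewrite mule_ge0 ?integral_ge0// inve_ge0.
  by apply: ereal_sup_ubound; exists (cube x 1).
have fin : hardy_littlewood f x \is a fin_num.
  rewrite ge0_fin_numE//; apply: (le_lt_trans (le_t (t + 1) _)); rewrite ?ltry//.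
  by rewrite ltrDl.
split=> //; rewrite ger0_norm ?fine_ge0//.
rewrite -tm -exprMn lerXn2r ?nnegrE ?fine_ge0 ?mulr_ge0 ?powR_ge0 ?(ltW K0)//.
rewrite -ler_pdivrMl//; apply/ler_addgt0Pr => e e0; rewrite ler_pdivrMl//.
rewrite -lee_fin fineK// mulrC; apply: le_t.
by rewrite ltrDl.
Qed.

End maximal_bound.

(** Adding the previous iterate keeps the level sets increasing, which replaces
    the almost everywhere comparison of a function with its median maximal
    function. *)
Fixpoint median_iterate {R : realType} {n : nat} (lam : R)
    (g : Rn R n -> R) (k : nat) : Rn R n -> R :=
  if k is j.+1 then median_iterate lam g j \+
    (fine \o median_maximal lam (median_iterate lam g j)) else g.

Lemma bfs_median_iterate (R : realType) (n : nat) (X : fun_space R n)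
    (lam C : R) (g : Rn R n -> R) :
  banach_function_space X -> 0 < C ->
  (forall f, X f -> [/\
    {ae @lebesgueRn R n, forall x, median_maximal lam f x \is a fin_num},
    X (fine \o median_maximal lam f) &
    fnorm X (fine \o median_maximal lam f) <= C * fnorm X f]) ->
  X g -> forall k, X (median_iterate lam g k) /\
    fnorm X (median_iterate lam g k) <= (1 + C) ^+ k * fnorm X g.
Proof.
move=> bfsX C0 bdd Xg; elim=> [|k [Xk nk]] /=; first by rewrite expr0 mul1r.
have [_ XT nT] := bdd _ Xk; split; first exact: bfsD.
apply: (le_trans (bfs_normD bfsX Xk XT)).
apply: (@le_trans _ _ ((1 + C) * fnorm X (median_iterate lam g k))).
  by rewrite mulrDl mul1r lerD2l.
by rewrite exprS -mulrA ler_wpM2l// addr_ge0// ltW.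
Qed.

Theorem theorem1p2 (R : realType) (n : nat) (n_gt0 : (0 < n)%N)
    (X : fun_space R n) (bfsX : banach_function_space X)
    (bddX : exists lambda : R,
      [/\ 0 < lambda, lambda < 1 & bounded_on (median_maximal lambda) X]) :
  exists p : R, 1 < p /\ bounded_on hardy_littlewood (fun_space_pow X p^-1).
Proof.
have [lam [lam0 lam1 [C [C0 bdd]]]] := bddX.
have gain0 := @growth_gain_gt0 R n _ lam0 lam1.
pose th := 1 + @growth_gain R n lam.
pose B := 1 + @growth_gain R n lam / 2.
have B1 : 1 < B by rewrite ltrDl divr_gt0.
have Bth : B < th by rewrite ltrD2l ltr_pdivrMr// ltr_pMr// ltr1n.
(* [1 + C] bounds the norm of one iteration on [X]; the factor 2 makes the
   series defining [G] geometric. *)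
pose D := 2 * (1 + C).
have D0 : 0 < D by rewrite mulr_gt0// addr_gt0.
have [k0 hk0] := expr_unbounded D B1.
(* The exponent [m] is a natural number with [D <= B ^+ m], so that the [m]-th
   root of [D] is at most [B < th]; the shift by 2 makes it larger than 1. *)
pose m := k0.+2.
have DB : D <= B ^+ m.
  by apply: (le_trans (ltW hk0)); rewrite ler_eXn2l// /m -addn2 leq_addr.
pose K := @maximal_constant R n lam B.
have K0 : 0 < K by exact: maximal_constant_gt0.
have powE (x : R) : 0 <= x -> x `^ (m%:R^-1)^-1 = x ^+ m.
  by move=> x0; rewrite invrK powR_mulrn.
exists m%:R; split; first by rewrite ltr1n.
exists ((2 * K ^+ m) `^ m%:R^-1); split.
  by rewrite powR_gt0// mulr_gt0// exprn_gt0.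
move=> f [/= mf Xg].
pose g := (fun x : Rn R n => `|f x| `^ (m%:R^-1)^-1).
pose u := median_iterate lam g.
have [Xu nu] := all_and2 (bfs_median_iterate bfsX C0 bdd Xg).
have fin_median : {ae @lebesgueRn R n, forall y, forall k,
    median_maximal lam (u k) y \is a fin_num}.
  by apply/ae_foralln => k; have [] := bdd _ (Xu k).
have mes_u k : measurable_fun setT (u k) by exact: bfs_measurable (Xu k).
have uE y : u 0 y = `|f y| ^+ m by rewrite /u/= /g powE.
have u_ge0 k y : 0 <= u k y.
  elim: k => [|k IH]; first by rewrite uE exprn_ge0.
  by rewrite /u/= addr_ge0// fine_ge0// median_maximal_ge0.
have [|||G [XG nG Gu]] := @bfs_dominate_series R n X bfsX
  (fun k x => D ^- k * u k x) (fnorm X g).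
- by move=> k; exact: bfsZ.
- by move=> k x; rewrite mulr_ge0// invr_ge0 exprn_ge0// ltW.
- move=> k; rewrite bfs_normZ// ger0_norm ?invr_ge0 ?exprn_ge0 ?(ltW D0)//.
  rewrite /D exprMn invfM -mulrA ler_wpM2l ?invr_ge0//.
  by rewrite ler_pdivrMl ?exprn_gt0 ?addr_gt0//.
have dom : {ae @lebesgueRn R n, forall x, hardy_littlewood f x \is a fin_num /\
    `|fine (hardy_littlewood f x)| ^+ m <= K ^+ m * G x}.
  have fm := fin_median; apply: filterS2 Gu fm => x Gx fx.
  exact: (hardy_littlewood_pow_le lam0 lam1 (ltn0Sn _) mf mes_u uE _ fin_median
    B1 Bth D0 DB fx Gx).
have mM : measurable_fun setT (fine \o hardy_littlewood f).
  apply: (measurableT_comp (fine_measurable measurableT)).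
  exact: measurable_hardy_littlewood.
have mMp : measurable_fun setT
    (fun x => `|(fine \o hardy_littlewood f) x| `^ (m%:R^-1)^-1).
  exact: (measurableT_comp (measurable_powR _) (measurable_normr_fun mM)).
have XKG : X (fun x => K ^+ m * G x) by exact: bfsZ.
have [|XM nM] := bfs_ideal bfsX XKG mMp.
  apply: filterS dom => x [_ h].
  by rewrite powE// ger0_norm ?exprn_ge0// (le_trans h)// ler_norm.
split.
- by apply: filterS dom => x [].
- by split.
have Km0 : 0 <= K ^+ m by rewrite exprn_ge0// ltW.
have c0 : 0 <= 2 * K ^+ m := mulr_ge0 (ler0n _ 2) Km0.
have A0 : 0 <= fnorm X g := bfs_norm_ge0 bfsX Xg.
rewrite /= -(powRM _ c0 A0).
apply: ge0_ler_powR; rewrite ?nnegrE ?invr_ge0//.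
- exact: bfs_norm_ge0.
- exact: mulr_ge0.
apply: (le_trans nM); rewrite bfs_normZ// ger0_norm//.
by rewrite (mulrC 2) -(mulrA (K ^+ m)) ler_wpM2l.
Qed.
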